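(* Let $\mathcal{H}=\mathcal{H}_0\otimes\mathcal{H}_1$ be a tensor product of finite-dimensional complex Hilbert spaces, let $H$ be a Hermitian operator on $\mathcal{H}$, and let $L$ be an operator acting in $\mathcal{H}_0$ (identified with $L\otimes I$ on $\mathcal{H}$). Define $\mathcal{D}_L\rho = L\rho L^\dagger-\frac12(L^\dagger L\rho+\rho L^\dagger L)$. Assume that the kernel of $\mathcal{D}_L$, viewed as a map on operators on $\mathcal{H}_0$, is nondegenerate (one-dimensional) and pure, i.e. it is spanned by $|\psi_{\rm Zeno}\rangle\langle\psi_{\rm Zeno}|$ for a unit vector $|\psi_{\rm Zeno}\rangle\in\mathcal{H}_0$. Assume that for every $\Gamma>0$ there is a unique density matrix $\rho_{\rm NESS}(\Gamma)$ on $\mathcal{H}$ satisfying $-i[H,\rho]+\Gamma\,\mathcal{D}_L\rho=0$. If there is a unit vector $|\psi_{\rm target}\rangle\in\mathcal{H}_1$ such that, with $|\Psi\rangle=|\psi_{\rm Zeno}\rangle\otimes|\psi_{\rm target}\rangle$, $$\lim_{\Gamma\to\infty}\rho_{\rm NESS}(\Gamma)=|\Psi\rangle\langle\Psi|,$$ then there exist numbers $\lambda,\kappa\in\mathbb{C}$ and a vector $|\psi_{\rm Zeno}^\perp\rangle\in\mathcal{H}_0$ with $\langle\psi_{\rm Zeno}|\psi_{\rm Zeno}^\perp\rangle=0$ such that $$H|\Psi\rangle=\lambda|\Psi\rangle+\kappa\,|\psi_{\rm Zeno}^\perp\rangle\otimes|\psi_{\rm target}\rangle.$$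
   Context: A density matrix is a positive semidefinite operator of trace one. The Lindblad master equation under consideration is $\partial\rho/\partial t=-i[H,\rho]+\Gamma\mathcal{D}_L\rho$ (with $\hbar=1$), where $\Gamma>0$ is the dissipative strength; a nonequilibrium steady state (NESS) is a time-independent density matrix solution. The limit $\Gamma\to\infty$ is called the Zeno limit. *)

(* Defs.v *)
From HB Require Import structures.
From mathcomp Require Import all_boot all_order all_algebra.
From mathcomp Require Import sesquilinear spectral.
From mathcomp Require Import complex mxtens.
From mathcomp Require Import all_classical all_reals all_analysis.

Set Implicit Arguments.
Unset Strict Implicit.
Unset Printing Implicit Defensive.

Import Order.TTheory GRing.Theory Num.Theory.
Import numFieldNormedType.Exports.
Local Open Scope ring_scope.

(* The norm topology on R[i]: without it the inference of the topology of
   'M[R[i]]_(m, n) does not see that R[i] is a numClosedFieldType.            *)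
HB.instance Definition _ (R : rcfType) :=
  NormedModule.copy R[i] (GRing.regular (R[i] : numClosedFieldType)).

(* A d-dimensional complex Hilbert space is C^d with kets as column vectors;
   an operator on it is a d x d matrix.  The tensor product C^m (x) C^n is
   C^(m * n), through the Kronecker product *t.                               *)

Definition dag (C : numClosedFieldType) m n (A : 'M[C]_(m, n)) : 'M[C]_(n, m) :=
  (A ^t* )%sesqui.

(* <u|v>, antilinear in u *)
Definition braket (C : numClosedFieldType) n (u v : 'cV[C]_n) : C :=
  (dag u *m v) 0 0.

(* |u><v| *)
Definition ketbra (C : numClosedFieldType) n (u v : 'cV[C]_n) : 'M[C]_n :=
  u *m dag v.

Definition unit_ket (C : numClosedFieldType) n (u : 'cV[C]_n) : Prop :=
  braket u u = 1.

(* u *t v has 1 * 1 columns, which is convertible to 1. *)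
Definition tens_ket (C : numClosedFieldType) m n
  (u : 'cV[C]_m) (v : 'cV[C]_n) : 'cV[C]_(m * n) := u *t v.

(* In a numClosedFieldType 0 <= z forces z to be real, so positivity of the
   quadratic form entails that A is Hermitian.                                *)
Definition psdmx (C : numClosedFieldType) n (A : 'M[C]_n) : Prop :=
  forall v : 'cV[C]_n, 0 <= braket v (A *m v).

Definition density_matrix (C : numClosedFieldType) n (rho : 'M[C]_n) : Prop :=
  psdmx rho /\ \tr rho = 1.

Definition commutator (C : numClosedFieldType) n (A B : 'M[C]_n) : 'M[C]_n :=
  A *m B - B *m A.

Definition dissipator (C : numClosedFieldType) n (L X : 'M[C]_n) : 'M[C]_n :=
  L *m X *m dag L - 2^-1 *: (dag L *m L *m X + X *m dag L *m L).

Lemma dissipator_is_linear (C : numClosedFieldType) n (L : 'M[C]_n) :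
  linear (dissipator L).
Proof.
move=> a X Y; rewrite /dissipator !(mulmxDr, mulmxDl) -!scalemxAr -!scalemxAl.
by rewrite [X in _ - 2^-1 *: X]addrACA -scalerDr [2^-1 *: (_ + _)]scalerDr
  opprD addrACA scalerA mulrC -scalerA -scalerBr.
Qed.

HB.instance Definition _ (C : numClosedFieldType) n (L : 'M[C]_n) :=
  GRing.isLinear.Build C 'M[C]_n 'M[C]_n _ (dissipator L)
    (dissipator_is_linear L).

(* Right-hand side of the Lindblad master equation, with hbar = 1. *)
Definition lindblad (R : realType) n (H L : 'M[R[i]]_n) (Gamma : R)
    (rho : 'M[R[i]]_n) : 'M[R[i]]_n :=
  - 'i *: commutator H rho + Gamma%:C%C *: dissipator L rho.

Definition is_NESS (R : realType) n (H L : 'M[R[i]]_n) (Gamma : R)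
    (rho : 'M[R[i]]_n) : Prop :=
  density_matrix rho /\ lindblad H L Gamma rho = 0.

(* Main.v *)
Require Import Defs.
From HB Require Import structures.
From mathcomp Require Import all_boot all_order all_algebra.
From mathcomp Require Import sesquilinear spectral.
From mathcomp Require Import complex mxtens.
From mathcomp Require Import all_classical all_reals all_analysis.

Set Implicit Arguments.
Unset Strict Implicit.
Unset Printing Implicit Defensive.

Import Order.TTheory GRing.Theory Num.Theory.
Import numFieldNormedType.Exports.
Local Open Scope classical_set_scope.
Local Open Scope ring_scope.

(* Write Psi = Zeno (x) target, D for the dissipator of L (x) 1 and
   T = 1 (x) |target><target|.  If tr(A D(rho)) = 0 for all steady states rho,
   stationarity gives tr([A, H] rho) = 0, hence <Psi|[A, H]|Psi> = 0 in the limit.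
   - With A = 1 (x) B, whose expectation D conserves, this shows that
     (|Zeno><Zeno| (x) 1) H Psi is a multiple of Psi.
   - Consequently tr([T, H] X) = 0 on the kernel of D, so there is an
     observable A with tr([T, H] X) = tr(A D(X)) for all X; this A again has
     <Psi|[A, H]|Psi> = 0.  When L Zeno = 0, that number is (up to a factor) the
     rate ||L A Psi||^2 + ||L A^+ Psi||^2 at which Psi leaks out of the range of
     T, and its vanishing forces H Psi = T H Psi.
   - L Zeno = c Zeno with c <> 0 is possible only if dim H_0 = 1, and then the
     first point suffices. *)

(** * Adjoints and the inner product *)

Lemma dagM (C : numClosedFieldType) m n p (A : 'M[C]_(m, n)) (B : 'M[C]_(n, p)) :
  dag (A *m B) = dag B *m dag A.
Proof. by rewrite /dag trmx_mul map_mxM. Qed.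

Lemma dagK (C : numClosedFieldType) m n : cancel (@dag C m n) (@dag C n m).
Proof. exact: trmxCK. Qed.

Lemma dagD (C : numClosedFieldType) m n (A B : 'M[C]_(m, n)) :
  dag (A + B) = dag A + dag B.
Proof. by rewrite /dag !raddfD. Qed.

Lemma dagB (C : numClosedFieldType) m n (A B : 'M[C]_(m, n)) :
  dag (A - B) = dag A - dag B.
Proof. by rewrite /dag !raddfB. Qed.

Lemma dagZ (C : numClosedFieldType) m n a (A : 'M[C]_(m, n)) :
  dag (a *: A) = a^* *: dag A.
Proof. by rewrite /dag linearZ /= map_mxZ. Qed.

Lemma dag1 (C : numClosedFieldType) n : dag (1%:M : 'M[C]_n) = 1%:M.
Proof. by rewrite /dag trmx1 map_mx1. Qed.

Lemma dag_tens (C : numClosedFieldType) m n p q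
    (A : 'M[C]_(m, n)) (B : 'M[C]_(p, q)) :
  dag (A *t B) = dag A *t dag B.
Proof. by rewrite /dag trmx_tens map_mxT. Qed.

Lemma dag_mul_ge0 (C : numClosedFieldType) n (v : 'cV[C]_n) :
  0 <= (dag v *m v) 0 0.
Proof.
rewrite mxE; apply: sumr_ge0 => i _.
by rewrite !mxE mulrC mul_conjC_ge0.
Qed.

Lemma dag_mul_eq0 (C : numClosedFieldType) n (v : 'cV[C]_n) :
  dag v *m v = 0 -> v = 0.
Proof.
move=> /matrixP/(_ 0 0); rewrite !mxE => v0.
apply/matrixP => i j; rewrite ord1 !mxE.
have := psumr_eq0P _ v0 => /(_ _ i isT); rewrite !mxE mulrC.
move=> /(_ _)/eqP; rewrite mul_conjC_eq0 => H; apply/eqP/H => k _.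
by rewrite !mxE mulrC mul_conjC_ge0.
Qed.

Lemma ket_ext (C : numClosedFieldType) n (u w : 'cV[C]_n) :
  (forall v : 'cV_n, dag v *m u = dag v *m w) -> u = w.
Proof.
move=> uw; apply/eqP; rewrite -subr_eq0; apply/eqP/dag_mul_eq0.
by rewrite mulmxBr uw subrr.
Qed.

(** * Linear functionals as trace pairings *)

Lemma mxtrace_mxvec (F : fieldType) n (B X : 'M[F]_n) :
  \tr (B *m X) = (mxvec X *m (mxvec B^T)^T) 0 0.
Proof.
rewrite /mxtrace mxE (reindex _ (curry_mxvec_bij _ _)) /=.
rewrite (eq_bigr (fun i => \sum_j B i j * X j i)); last first.
  by move=> i _; rewrite mxE.
rewrite exchange_big pair_bigA /=; apply: eq_bigr => -[i j] _ /=.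
by rewrite mxE !mxvecE mxE mulrC.
Qed.

(** With [M] the matrix of [f] on row vectors, [1%:M - M *m pinvmx M] maps into the kernel of [M],
    where pairing with [B] gives zero. Hence [pinvmx M *m b] represents the functional on the image
    of [f]. *)
Lemma functional_factor (F : fieldType) n (f : {linear 'M[F]_n -> 'M[F]_n})
    (B : 'M[F]_n) :
  (forall X, f X = 0 -> \tr (B *m X) = 0) ->
  exists A : 'M[F]_n, forall X, \tr (B *m X) = \tr (A *m f X).
Proof.
move=> kerB; pose M := lin_mx f; pose b := (mxvec B^T)^T.
exists (vec_mx (pinvmx M *m b)^T)^T => X.
rewrite !mxtrace_mxvec trmxK vec_mxK trmxK -/b mulmxA -(mul_vec_lin f) -/M.
apply/eqP; rewrite -subr_eq0 -!mulmxA.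
rewrite (_ : _ - _ = ((mxvec X *m (1%:M - M *m pinvmx M)) *m b) 0 0); last first.
  by rewrite mulmxBr mulmx1 mulmxBl !mulmxA [RHS]mxE [X in _ = _ + X]mxE.
rewrite -[mxvec X *m _]vec_mxK -[b]/((mxvec B^T)^T) -mxtrace_mxvec; apply/eqP/kerB.
apply: (can_inj mxvecK); rewrite -mul_vec_lin vec_mxK -/M linear0 -mulmxA.
by rewrite mulmxBl mul1mx mulmxKpV // subrr mulmx0.
Qed.

(** * Conserved observables and pure kernels of the dissipator *)

(** Cyclicity of the trace moves the dissipator onto the observable: the factor in front of [X] is
    the Heisenberg-picture dissipator of [A]. *)
Lemma mxtrace_dissipator (C : numClosedFieldType) n (L A X : 'M[C]_n) :
  \tr (A *m dissipator L X) =
  \tr ((dag L *m A *m L - 2^-1 *: (dag L *m L *m A + A *m dag L *m L)) *m X).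
Proof.
rewrite /dissipator mulmxBr mulmxBl !raddfB /=; congr (_ - _).
  by rewrite mulmxA mxtrace_mulC !mulmxA.
rewrite -scalemxAr -scalemxAl !linearZ /= mulmxDr mulmxDl !raddfD /= addrC.
congr (_ * (_ + _)); last by rewrite !mulmxA.
by rewrite !mulmxA -mulmxA mxtrace_mulC !mulmxA.
Qed.

(** The commutations turn the jump term and both anticommutator terms into [dag L *m L *m A], with
    total weight 1 - 1/2 - 1/2. *)
Lemma dissipator_conserved (C : numClosedFieldType) n (L A X : 'M[C]_n) :
  A *m L = L *m A -> A *m dag L = dag L *m A -> \tr (A *m dissipator L X) = 0.
Proof.
move=> AL ALd; rewrite mxtrace_dissipator.
rewrite ALd -[dag L *m A *m L]mulmxA AL !mulmxA.
by rewrite -mulr2n -[_ *m A *+ 2]scaler_nat scalerA mulVf ?pnatr_eq0 // scale1r subrr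
  mul0mx mxtrace0.
Qed.

(** A component of [L *m Z] orthogonal to [Z] would be populated by quantum jumps, so stationarity
    excludes it. *)
Lemma pure_stationary_eigen (C : numClosedFieldType) n (L : 'M[C]_n)
    (Z : 'cV[C]_n) :
  unit_ket Z -> dissipator L (ketbra Z Z) = 0 ->
  exists c, L *m Z = c *: Z /\ (c = 0 \/ dag L *m Z = c^* *: Z).
Proof.
rewrite /unit_ket /braket /ketbra => Z1 DZ.
have ZZ : dag Z *m Z = 1%:M by rewrite [LHS]mx11_scalar Z1.
pose c := (dag Z *m (L *m Z)) 0 0.
have [phi phiE] : {phi | phi = L *m Z - c *: Z} by exists (L *m Z - c *: Z).
have Zphi : dag Z *m phi = 0.
  by rewrite phiE mulmxBr -scalemxAr ZZ [X in X - _]mx11_scalar -/c scalemx1 subrr.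
have phiZ : dag phi *m Z = 0.
  by rewrite -[_ *m _]dagK dagM dagK Zphi /dag trmx0 map_mx0.
have LZ : L *m Z = c *: Z.
  apply/eqP; rewrite -subr_eq0; apply/eqP; apply: dag_mul_eq0; rewrite -phiE.
  (* As [phi] is orthogonal to [Z], only the jump term survives; it equals |<phi|LZ>|^2 =
     ||phi||^4. *)
  have : dag phi *m dissipator L (Z *m dag Z) *m phi = 0.
    by rewrite DZ mulmx0 mul0mx.
  rewrite /dissipator mulmxBr mulmxBl -scalemxAr -scalemxAl mulmxDr mulmxDl.
  rewrite -!mulmxA Zphi [dag phi *m (Z *m _)]mulmxA phiZ mul0mx !mulmx0 addr0.
  rewrite scaler0 subr0.
  have LZphi : dag phi *m (L *m Z) = dag phi *m phi.
    by rewrite -[L *m Z](subrK (c *: Z)) -phiE mulmxDr -scalemxAr phiZ scaler0 addr0.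
  have -> : dag phi *m (L *m (Z *m (dag Z *m (dag L *m phi)))) =
      dag phi *m (L *m Z) *m dag (dag phi *m (L *m Z)).
    by rewrite !dagM dagK !mulmxA.
  rewrite LZphi dagM dagK; set x := dag phi *m phi.
  rewrite [x]mx11_scalar -scalar_mxM => /matrixP/(_ 0 0).
  by rewrite !mxE eqxx mulr1n => /eqP; rewrite mulf_eq0 orbb => /eqP ->;
    rewrite raddf0.
exists c; split=> //.
have [->|c0] := eqVneq c 0; [by left | right].
have ZL : dag Z *m dag L = c^* *: dag Z by rewrite -dagM LZ dagZ.
(* Applied to [Z], stationarity reads |c|^2 Z = (c L^+ Z + |c|^2 Z) / 2, from which [c] cancels. *)
have : dissipator L (Z *m dag Z) *m Z = 0 by rewrite DZ mul0mx.
rewrite /dissipator mulmxBl -scalemxAl mulmxDl.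
have -> : L *m (Z *m dag Z) *m dag L *m Z = (c * c^*) *: Z.
  by rewrite mulmxA LZ -scalemxAl -mulmxA -scalemxAl -!mulmxA (mulmxA (dag Z))
    ZL -scalemxAl ZZ -scalemxAr mulmx1 scalerA.
have -> : dag L *m L *m (Z *m dag Z) *m Z = c *: (dag L *m Z).
  by rewrite -!mulmxA ZZ mulmx1 LZ scalemxAr.
have -> : Z *m dag Z *m dag L *m L *m Z = (c * c^*) *: Z.
  by rewrite -!mulmxA LZ -!scalemxAr (mulmxA (dag Z)) ZL -scalemxAl ZZ -scalemxAr
    mulmx1 scalerA.
move/eqP; rewrite subr_eq0 => /eqP/(congr1 (fun M => 2 *: M)).
rewrite scalerA mulfV ?pnatr_eq0 // scale1r scaler_nat mulr2n => /addIr.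
by rewrite -scalerA => /(scalerI c0) ->.
Qed.

Lemma pure_kernel_full (C : numClosedFieldType) n
    (f : {linear 'M[C]_n -> 'M[C]_n}) (Z : 'cV[C]_n) :
  unit_ket Z -> lker (linfun f) = <[ketbra Z Z]>%VS ->
  (forall X, \tr (f X) = 0) -> (forall X, \tr (ketbra Z Z *m f X) = 0) ->
  ketbra Z Z = 1%:M.
Proof.
rewrite /unit_ket /braket /ketbra => Z1 kerf trf trZf.
have ZZ : dag Z *m Z = 1%:M by rewrite [LHS]mx11_scalar Z1.
have trP : \tr (Z *m dag Z) = 1 by rewrite mxtrace_mulC ZZ mxtrace1.
have PP : Z *m dag Z *m (Z *m dag Z) = Z *m dag Z.
  by rewrite -mulmxA (mulmxA (dag Z)) ZZ mul1mx.
(* The image of [f] is traceless, so it meets its kernel trivially; hence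
   [1 = f X + a P], and pairing with [P] and with [1] gives [n = 1]. *)
have disj : (limg (linfun f) :&: lker (linfun f) = 0)%VS.
  apply/eqP; rewrite -subv0; apply/subvP => X; rewrite memv_cap kerf.
  case/andP => /memv_imgP[Y _ ->] /vlineP[k]; rewrite lfunE => fYk.
  have := trf Y; rewrite fYk linearZ /= trP mulr1 => ->.
  by rewrite scale0r mem0v.
have full : (limg (linfun f) + lker (linfun f) = fullv)%VS.
  apply/eqP; rewrite eqEdim subvf /= dimv_disjoint_sum //.
  by rewrite -(limg_ker_dim (linfun f) fullv) capfv addnC.
have : (1%:M : 'M[C]_n) \in (limg (linfun f) + lker (linfun f))%VS.
  by rewrite full memvf.
case/memv_addP => _ /memv_imgP[X _ ->] [_ /[!kerf]/vlineP[a ->]].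
rewrite lfunE => I1.
have a1 : a = 1.
  have := congr1 (fun M => \tr (Z *m dag Z *m M)) I1.
  by rewrite mulmx1 mulmxDr raddfD /= trZf add0r -scalemxAr PP linearZ /= trP mulr1.
have := congr1 mxtrace I1; rewrite raddfD /= trf add0r a1 scale1r trP mxtrace1.
move/eqP; rewrite pnatr_eq1 => /eqP n1.
(* In dimension one [Y] is a square matrix, so its left inverse [dag Y] is also a right inverse. *)
suff square1 m (Y : 'cV[C]_m) :
    m = 1%N -> dag Y *m Y = 1%:M -> Y *m dag Y = 1%:M.
  exact: square1.
by move=> m1; move: Y; rewrite m1 => Y; exact: mulmx1C.
Qed.

(** * Dark states and leakage out of the range of [T] *)

Lemma mulmx_outer_trace (C : numClosedFieldType) n (B : 'M[C]_n) (u v : 'cV[C]_n) :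
  \tr (B *m (u *m dag v)) = (dag v *m (B *m u)) 0 0.
Proof. by rewrite mulmxA mxtrace_mulC trace_mx11. Qed.

(** Since [L] kills [u], only the anticommutator term that acts on the bra survives. *)
Lemma dissipator_dark_l (C : numClosedFieldType) n (L : 'M[C]_n)
    (u v : 'cV[C]_n) : L *m u = 0 ->
  dissipator L (u *m dag v) = - 2^-1 *: (u *m dag (dag L *m L *m v)).
Proof.
move=> Lu; rewrite /dissipator (mulmxA L) Lu !mul0mx sub0r.
have -> : dag L *m L *m (u *m dag v) = 0.
  by rewrite mulmxA -(mulmxA (dag L)) Lu mulmx0 mul0mx.
by rewrite add0r scaleNr !dagM dagK !mulmxA.
Qed.

Lemma dissipator_dark_r (C : numClosedFieldType) n (L : 'M[C]_n)
    (u v : 'cV[C]_n) : L *m u = 0 ->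
  dissipator L (v *m dag u) = - 2^-1 *: (dag L *m L *m v *m dag u).
Proof.
move=> Lu; have uLd : dag u *m dag L = 0 by rewrite -dagM Lu /dag trmx0 map_mx0.
have vuLd : v *m dag u *m dag L = 0 by rewrite -mulmxA uLd mulmx0.
by rewrite /dissipator -(mulmxA L) vuLd mulmx0 mul0mx addr0 sub0r scaleNr !mulmxA.
Qed.

(** With [K = dag L *m L], [a = A *m Psi], [b = dag A *m Psi] and [eta] the part of [H *m Psi]
    outside the range of [T], the factorisation of [T, H] gives K a = 2 eta and K b = -2 eta. The
    vanishing expectation of [A, H] gives <b|eta> = <eta|a>, so <a|Ka> + <b|Kb> = 0 and both terms
    vanish. *)
Lemma target_invariant (C : numClosedFieldType) n (H L T A : 'M[C]_n)
    (Psi : 'cV[C]_n) :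
  dag H = H -> dag T = T -> T *m T = T -> T *m Psi = Psi -> L *m Psi = 0 ->
  T *m L = L *m T -> T *m dag L = dag L *m T ->
  (forall v : 'cV_n, T *m v = v -> L *m v = 0 -> v = Psi *m (dag Psi *m v)) ->
  (forall X, \tr (commutator T H *m X) = \tr (A *m dissipator L X)) ->
  dag Psi *m (commutator A H *m Psi) = 0 ->
  T *m (H *m Psi) = H *m Psi.
Proof.
move=> Hh Th TT TPsi LPsi TL TLd kerLT GA expA.
pose K := dag L *m L.
have PsiLd : dag Psi *m dag L = 0 by rewrite -dagM LPsi /dag trmx0 map_mx0.
have PsiT : dag Psi *m T = dag Psi by rewrite -[T]Th -dagM TPsi.
have Kh : dag K = K by rewrite dagM dagK.
have KPsi : K *m Psi = 0 by rewrite -mulmxA LPsi mulmx0.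
have PsiK : dag Psi *m K = 0 by rewrite -Kh -dagM KPsi /dag trmx0 map_mx0.
have two0 : (2 : C) != 0 by rewrite pnatr_eq0.
have conj2V : (2^-1 : C)^* = 2^-1 by rewrite fmorphV rmorph_nat.
have [h hE] : {h | h = H *m Psi} by exists (H *m Psi).
have [eta etaE] : {eta | eta = h - T *m h} by exists (h - T *m h).
have [a aE] : {a | a = A *m Psi} by exists (A *m Psi).
have [b bE] : {b | b = dag A *m Psi} by exists (dag A *m Psi).
(* Test [GA] on the coherences |Psi><v|; here [T, H] Psi = -eta. *)
have Ka : K *m a = 2 *: eta.
  apply: ket_ext => v; rewrite -scalemxAr.
  have := GA (Psi *m dag v); rewrite dissipator_dark_l // -scalemxAr linearZ /=.
  rewrite !mulmx_outer_trace -/K dagM Kh -aE -mulmxA.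
  have -> : commutator T H *m Psi = - eta.
    by rewrite /commutator mulmxBl -!mulmxA TPsi -hE etaE opprB.
  rewrite mulmxN [in LHS]mxE mulNr => /oppr_inj E.
  apply/matrixP => i j; rewrite !ord1 [RHS]mxE E mulrA mulfV // mul1r.
  by [].
(* Test [GA] on |v><Psi| and conjugate the result to return to kets. *)
have Kb : K *m b = - (2 *: eta).
  apply: ket_ext => v; rewrite mulmxN -scalemxAr.
  have := GA (v *m dag Psi); rewrite dissipator_dark_r // -scalemxAr linearZ /=.
  rewrite !mulmx_outer_trace -/K !mulmxA.
  have -> : dag Psi *m commutator T H = dag eta.
    by rewrite /commutator mulmxBr !mulmxA PsiT etaE hE dagB !dagM Hh Th.
  have -> : dag Psi *m A = dag b by rewrite bE dagM dagK.
  rewrite mulNr => E.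
  have := congr1 Num.conj E; rewrite rmorphN rmorphM /= conj2V.
  have conjE (M : 'M[C]_1) : (M 0 0)^* = (dag M) 0 0 by rewrite !mxE.
  rewrite !conjE !dagM !dagK !mulmxA => {}E.
  apply/matrixP => i j; rewrite !ord1 [RHS]mxE [X in _ = - X]mxE E mulrN opprK.
  by rewrite mulrA mulfV // mul1r.
have Teta : T *m eta = 0 by rewrite etaE mulmxBr mulmxA TT subrr.
have TK : T *m K = K *m T by rewrite /K mulmxA TLd -!mulmxA TL.
(* [T] commutes with [K] and kills [eta], so K T x = 0; hence L T x = 0 and [kerLT] applies. *)
have Tker (x : 'cV[C]_n) (k : C) : K *m x = k *: eta ->
    T *m x = Psi *m (dag Psi *m x).
  move=> Kx; rewrite (kerLT (T *m x)) ?(mulmxA T) ?TT //.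
    by rewrite (mulmxA (dag Psi)) PsiT.
  apply: dag_mul_eq0; rewrite dagM -mulmxA (mulmxA (dag L)) -/K.
  by rewrite (mulmxA K) -TK -mulmxA Kx -scalemxAr Teta scaler0 mulmx0.
have Ta := Tker _ _ Ka; have Tb : T *m b = Psi *m (dag Psi *m b).
  by apply: (Tker _ (- 2)); rewrite Kb scaleNr.
set s := dag Psi *m a in Ta; set e := dag Psi *m h.
have sb : dag Psi *m b = dag s by rewrite /s aE bE !dagM dagK mulmxA.
have eh : dag e = e by rewrite /e hE !dagM dagK Hh mulmxA.
have se : s *m e = e *m s.
  by rewrite [s]mx11_scalar [e]mx11_scalar -!scalar_mxM mulrC.
have split_ x y : dag x *m y = dag (T *m x) *m y + dag x *m (y - T *m y).
  by rewrite dagM Th mulmxBr mulmxA addrC subrK.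
(* Splitting [<h|a> = <b|h>] along [T] and [1 - T], the [T] parts cancel. *)
have ha_bh : dag h *m a = dag b *m h.
  apply/esym/eqP; rewrite -subr_eq0; apply/eqP; rewrite -[RHS]expA /commutator.
  by rewrite mulmxBl mulmxBr -!mulmxA -hE -aE !mulmxA bE hE !dagM dagK Hh.
have eta_ab : dag b *m eta = dag eta *m a.
  have bh : dag b *m h = s *m e + dag b *m eta.
    by rewrite split_ Tb sb dagM dagK -mulmxA -/e etaE.
  have ah : dag a *m h = dag s *m e + dag a *m eta.
    by rewrite split_ Ta dagM -mulmxA -/e etaE.
  have := congr1 (@dag _ _ _) ah; rewrite dagM dagK ha_bh bh.
  rewrite dagD (dagM _ e) (dagM _ eta) !dagK eh se.
  exact: addrI.
(* The number <a|eta> = <a|Ka> / 2 is real. *)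
have aeta : dag a *m eta = dag eta *m a.
  apply: (scalerI two0); rewrite scalemxAr -Ka scalemxAl -[2 *: dag eta]dagK.
  by rewrite dagZ rmorph_nat dagK -Ka dagM Kh mulmxA.
have : dag (L *m a) *m (L *m a) + dag (L *m b) *m (L *m b) = 0.
  rewrite !dagM -!mulmxA !(mulmxA (dag L)) -/K Ka Kb mulmxN -!scalemxAr eta_ab.
  by rewrite aeta subrr.
move=> /matrixP/(_ 0 0); rewrite [LHS]mxE [RHS]mxE => /eqP.
rewrite paddr_eq0 ?dag_mul_ge0 // => /andP[/eqP La0 _].
have {}La0 : L *m a = 0 by apply: dag_mul_eq0; rewrite [LHS]mx11_scalar La0 raddf0.
have eta0 : eta = 0.
  by apply: (scalerI two0); rewrite -Ka -mulmxA La0 mulmx0 scaler0.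
by apply/esym/eqP; rewrite -subr_eq0 -hE -etaE eta0.
Qed.

(** * Linear identities for steady states and their limit *)

Lemma cvg_mxtrace_mul (R : realType) (T : Type) (F : set_system T) n
    (G M : 'M[R[i]]_n) (rho : T -> 'M[R[i]]_n) : Filter F ->
  rho x @[x --> F] --> M -> \tr (G *m rho x) @[x --> F] --> \tr (G *m M).
Proof.
move=> FF rhoM.
have -> : (fun x => \tr (G *m rho x)) =
    (fun x => \sum_i \sum_j G i j * rho x j i).
  by apply/funext => x; apply: eq_bigr => i _; rewrite mxE.
have -> : \tr (G *m M) = \sum_i \sum_j G i j * M j i.
  by apply: eq_bigr => i _; rewrite mxE.
apply: cvg_big => [|i _]; first exact: add_continuous.
apply: cvg_big => [|j _]; first exact: add_continuous.
apply: cvgM; first exact: cvg_cst.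
have cont := @coord_continuous R[i] n n j i M.
exact: (@continuous_cvg _ _ _ F FF _ (fun M : 'M[R[i]]_n => M j i) _ cont rhoM).
Qed.

Lemma mxtrace_limit_eq0 (R : realType) n (G M : 'M[R[i]]_n)
    (rho : R -> 'M[R[i]]_n) :
  (forall Gamma, 0 < Gamma -> \tr (G *m rho Gamma) = 0) ->
  rho Gamma @[Gamma --> +oo] --> M -> \tr (G *m M) = 0.
Proof.
move=> G0 rhoM.
have trM : \tr (G *m rho Gamma) @[Gamma --> +oo] --> \tr (G *m M).
  exact: cvg_mxtrace_mul.
have tr0 : \tr (G *m rho Gamma) @[Gamma --> +oo] --> (0 : R[i]).
  apply: cvg_near_cst; near=> Gamma; apply: G0; near: Gamma.
  exact: nbhs_pinfty_gt.
have hausdorff : hausdorff_space R[i] := @norm_hausdorff _ _.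
exact: (cvg_unique hausdorff trM tr0).
Unshelve. all: by end_near. Qed.

(** Pairing the steady-state equation with [A] removes the only term that contains [Gamma], so the
    resulting identity can pass to the Zeno limit. *)
Lemma is_NESS_stationary (R : realType) n (H L A : 'M[R[i]]_n) (Gamma : R) rho :
  is_NESS H L Gamma rho -> \tr (A *m dissipator L rho) = 0 ->
  \tr (commutator A H *m rho) = 0.
Proof.
case=> _ /(congr1 (fun M => \tr (A *m M))); rewrite mulmx0 mxtrace0 /lindblad.
rewrite mulmxDr -!scalemxAr mxtraceD !mxtraceZ => + D0.
rewrite D0 mulr0 addr0 => /eqP; rewrite mulf_eq0 oppr_eq0 (negPf (@neq0Ci _)) /=.
move=> /eqP.
rewrite /commutator mulmxBr mulmxBl !raddfB /= mulmxA [in X in _ - X]mulmxA.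
by rewrite (mxtrace_mulC (A *m rho)) mulmxA.
Qed.

(** * Kronecker products of kets and operators *)

Lemma tens_mul_ket (C : numClosedFieldType) m n (A : 'M[C]_m) (B : 'M[C]_n)
    (u : 'cV[C]_m) (v : 'cV[C]_n) :
  (A *t B) *m tens_ket u v = tens_ket (A *m u) (B *m v).
Proof. exact: (tensmx_mul A B u v). Qed.

Lemma braket_tens (C : numClosedFieldType) m n (u u' : 'cV[C]_m) (v v' : 'cV[C]_n) :
  dag (tens_ket u v) *m tens_ket u' v' =
  (braket u u' * braket v v')%:M.
Proof.
have -> : dag (tens_ket u v) *m tens_ket u' v' = (dag u *m u') *t (dag v *m v').
  by rewrite -tensmx_mul -dag_tens.
by apply/matrixP => i j; rewrite !ord1 !mxE !ord1 eqxx mulr1n /braket !mxE.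
Qed.

Lemma ketbra_tens (C : numClosedFieldType) m n (u : 'cV[C]_m) (v : 'cV[C]_n) :
  ketbra (tens_ket u v) (tens_ket u v) = ketbra u u *t ketbra v v.
Proof. by rewrite /ketbra -tensmx_mul -dag_tens. Qed.

Lemma tens_ketDl (C : numClosedFieldType) m n (u u' : 'cV[C]_m) (v : 'cV[C]_n) :
  tens_ket (u + u') v = tens_ket u v + tens_ket u' v.
Proof. by apply/matrixP => i j; rewrite !mxE mulrDl. Qed.

Lemma tens_ketZl (C : numClosedFieldType) m n k (u : 'cV[C]_m) (v : 'cV[C]_n) :
  tens_ket (k *: u) v = k *: tens_ket u v.
Proof. by apply/matrixP => i j; rewrite !mxE mulrA. Qed.

Lemma tens_ketZr (C : numClosedFieldType) m n k (u : 'cV[C]_m) (v : 'cV[C]_n) :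
  tens_ket u (k *: v) = k *: tens_ket u v.
Proof. by apply/matrixP => i j; rewrite !mxE mulrCA. Qed.

Lemma sum_mxtens (V : nmodType) m n (F : 'I_(m * n) -> V) :
  \sum_k F k = \sum_i \sum_j F (mxtens_index (i, j)).
Proof.
rewrite pair_bigA (reindex (@mxtens_index m n)) /=; last first.
  by apply: onW_bij; exists (@mxtens_unindex m n);
    [exact: mxtens_indexK | exact: mxtens_unindexK].
by apply: eq_bigr => -[].
Qed.

Lemma tensmx1_mulE (C : numClosedFieldType) m n p (A : 'M[C]_m)
    (X : 'M[C]_(m * n, p)) i b c :
  ((A *t (1%:M : 'M[C]_n)) *m X) (mxtens_index (i, b)) c =
  \sum_k A i k * X (mxtens_index (k, b)) c.
Proof.
rewrite mxE sum_mxtens; apply: eq_bigr => k _.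
rewrite (bigD1 b) //= big1 ?addr0 => [|b' bb']; rewrite tensmxE mxE.
  by rewrite eqxx mulr1.
by rewrite eq_sym (negPf bb') mulr0 mul0r.
Qed.

Lemma tensmx1_mulE_r (C : numClosedFieldType) m n p (A : 'M[C]_m)
    (X : 'M[C]_(p, m * n)) i b c :
  (X *m (A *t (1%:M : 'M[C]_n))) c (mxtens_index (i, b)) =
  \sum_k X c (mxtens_index (k, b)) * A k i.
Proof.
rewrite mxE sum_mxtens; apply: eq_bigr => k _.
rewrite (bigD1 b) //= big1 ?addr0 => [|b' bb']; rewrite tensmxE mxE.
  by rewrite eqxx mulr1.
by rewrite (negPf bb') !mulr0.
Qed.

Lemma tens1mx_mulE (C : numClosedFieldType) m n p (B : 'M[C]_n)
    (X : 'M[C]_(m * n, p)) i b c :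
  (((1%:M : 'M[C]_m) *t B) *m X) (mxtens_index (i, b)) c =
  \sum_k B b k * X (mxtens_index (i, k)) c.
Proof.
rewrite mxE sum_mxtens (bigD1 i) //= [X in _ + X]big1 ?addr0 => [|i' ii'].
  by apply: eq_bigr => k _; rewrite tensmxE mxE eqxx mul1r.
by apply: big1 => k _; rewrite tensmxE mxE eq_sym (negPf ii') !mul0r.
Qed.

Lemma tens_ketE (C : numClosedFieldType) m n (u : 'cV[C]_m) (v : 'cV[C]_n) i b c :
  tens_ket u v (mxtens_index (i, b)) c = u i 0 * v b 0.
Proof. by rewrite /tens_ket mxE mxtens_indexK !ord1. Qed.

Lemma ketbra_tens1_mul (C : numClosedFieldType) m n (u : 'cV[C]_m)
    (x : 'cV[C]_(m * n)) :
  exists w, (ketbra u u *t 1%:M) *m x = tens_ket u w.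
Proof.
(* The partial contraction of [x] with <u| on the first factor. *)
exists (\col_b \sum_k (u k 0)^* * x (mxtens_index (k, b)) 0).
apply/matrixP => k c; case: (mxtens_indexP k) => i b.
rewrite tensmx1_mulE tens_ketE mxE big_distrr; apply: eq_bigr => j _ /=.
by rewrite mxE big_ord1 !mxE mulrA !ord1.
Qed.

Lemma tens1_ketbra_mul (C : numClosedFieldType) m n (v : 'cV[C]_n)
    (x : 'cV[C]_(m * n)) :
  exists w, (1%:M *t ketbra v v) *m x = tens_ket w v.
Proof.
exists (\col_i \sum_k (v k 0)^* * x (mxtens_index (i, k)) 0).
apply/matrixP => k c; case: (mxtens_indexP k) => i b.
rewrite tens1mx_mulE tens_ketE mxE mulrC big_distrr; apply: eq_bigr => j _ /=.
by rewrite mxE big_ord1 !mxE mulrA !ord1.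
Qed.

Lemma tens1mx1 (C : numClosedFieldType) m n :
  (1%:M : 'M[C]_m) *t (1%:M : 'M[C]_n) = 1%:M.
Proof.
apply/matrixP => k l; case: (mxtens_indexP k) (mxtens_indexP l) => i b [j b'].
rewrite tensmxE !mxE (can_eq (@mxtens_indexK _ _)) xpair_eqE.
by case: (i == j); rewrite ?mul1r ?mul0r.
Qed.

(** * The kernel of the dissipator on the tensor product *)

(** The block of [X] between basis vectors [b] and [b'] of the second factor. Operators [A *t 1%:M]
    act block by block, which reduces questions about [L *t 1%:M] to [L]. *)
Definition slice (C : numClosedFieldType) m n b b' (X : 'M[C]_(m * n)) : 'M[C]_m :=
  \matrix_(i, j) X (mxtens_index (i, b)) (mxtens_index (j, b')).

Lemma slice_mull (C : numClosedFieldType) m n b b' (A : 'M[C]_m) (X : 'M[C]_(m * n)) :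
  slice b b' ((A *t 1%:M) *m X) = A *m slice b b' X.
Proof.
apply/matrixP => i j; rewrite [LHS]mxE tensmx1_mulE [RHS]mxE.
by apply: eq_bigr => k _; rewrite mxE.
Qed.

Lemma slice_mulr (C : numClosedFieldType) m n b b' (A : 'M[C]_m) (X : 'M[C]_(m * n)) :
  slice b b' (X *m (A *t 1%:M)) = slice b b' X *m A.
Proof.
apply/matrixP => i j; rewrite [LHS]mxE tensmx1_mulE_r [RHS]mxE.
by apply: eq_bigr => k _; rewrite mxE.
Qed.

Lemma slice_dissipator (C : numClosedFieldType) m n b b' (L : 'M[C]_m)
    (X : 'M[C]_(m * n)) :
  slice b b' (dissipator (L *t 1%:M) X) = dissipator L (slice b b' X).
Proof.
rewrite /dissipator dag_tens dag1 -!slice_mull -!slice_mulr.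
rewrite tensmx_mul mulmx1.
by apply/matrixP => i j; rewrite !mxE.
Qed.

Lemma slice_inj (C : numClosedFieldType) m n (X Y : 'M[C]_(m * n)) :
  (forall b b', slice b b' X = slice b b' Y) -> X = Y.
Proof.
move=> XY; apply/matrixP => k l.
case: (mxtens_indexP k) (mxtens_indexP l) => i b [j b'].
by have /matrixP/(_ i j) := XY b b'; rewrite !mxE.
Qed.

(** Each block of [X] lies in the kernel for [L], hence is a multiple of [ketbra Z Z], which that
    projector fixes on both sides. *)
Lemma dissipator_tens_kernel (C : numClosedFieldType) m n (L : 'M[C]_m)
    (Z : 'cV[C]_m) (X : 'M[C]_(m * n)) :
  unit_ket Z -> lker (linfun (dissipator L)) = <[ketbra Z Z]>%VS ->
  dissipator (L *t 1%:M) X = 0 ->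
  (ketbra Z Z *t 1%:M) *m X *m (ketbra Z Z *t 1%:M) = X.
Proof.
rewrite /unit_ket /braket => Z1 kerL DX; apply: slice_inj => b b'.
have ZZ : dag Z *m Z = 1%:M by rewrite [LHS]mx11_scalar Z1.
rewrite slice_mulr slice_mull.
have /vlineP[k ->] : slice b b' X \in <[ketbra Z Z]>%VS.
  rewrite -kerL memv_ker lfunE /= -slice_dissipator DX.
  by apply/eqP/matrixP => i j; rewrite !mxE.
rewrite -scalemxAr -scalemxAl /ketbra -!mulmxA (mulmxA (dag Z) Z) ZZ mul1mx.
by rewrite (mulmxA (dag Z) Z) ZZ mul1mx.
Qed.

(** * The action of [H] on the limiting pure state *)

Theorem theorem1 (R : realType) (n0 n1 : nat)
  (H : 'M[R[i]]_(n0 * n1)) (L : 'M[R[i]]_n0)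
  (psi_Zeno : 'cV[R[i]]_n0)
  (rho_NESS : R -> 'M[R[i]]_(n0 * n1))
  (H_hermitian : H \is hermsymmx)
  (psi_Zeno_unit : unit_ket psi_Zeno)
  (ker_dissipator :
     lker (linfun (dissipator L)) = <[ketbra psi_Zeno psi_Zeno]>%VS)
  (rho_NESS_unique : forall Gamma : R, 0 < Gamma ->
     unique (is_NESS H (L *t (1%:M : 'M[R[i]]_n1)) Gamma) (rho_NESS Gamma))
  (psi_target : 'cV[R[i]]_n1)
  (psi_target_unit : unit_ket psi_target)
  (Zeno_limit :
     rho_NESS Gamma @[Gamma --> +oo] -->
       ketbra (tens_ket psi_Zeno psi_target) (tens_ket psi_Zeno psi_target)) :
  exists (lambda kappa : R[i]) (psi_Zeno_perp : 'cV[R[i]]_n0),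
    braket psi_Zeno psi_Zeno_perp = 0 /\
    H *m tens_ket psi_Zeno psi_target =
      lambda *: tens_ket psi_Zeno psi_target
      + kappa *: tens_ket psi_Zeno_perp psi_target.
Proof.
set P := ketbra psi_Zeno psi_Zeno; set t := psi_target; set Z := psi_Zeno.
set Psi := tens_ket Z t; set Lt := L *t (1%:M : 'M[R[i]]_n1).
pose Pt := P *t (1%:M : 'M[R[i]]_n1).
pose T := (1%:M : 'M[R[i]]_n0) *t ketbra t t.
have Hh : dag H = H.
  by have /is_hermitianmxP := H_hermitian; rewrite expr0 scale1r => /esym.
have ZZ : dag Z *m Z = 1%:M by rewrite [LHS]mx11_scalar [X in X%:M]psi_Zeno_unit.
have tt : dag t *m t = 1%:M by rewrite [LHS]mx11_scalar [X in X%:M]psi_target_unit.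
have Psi1 : dag Psi *m Psi = 1%:M.
  by rewrite braket_tens psi_Zeno_unit psi_target_unit mulr1.
have ketbrah n (v : 'cV[R[i]]_n) : dag (ketbra v v) = ketbra v v.
  by rewrite /ketbra dagM dagK.
have Th : dag T = T by rewrite dag_tens dag1 ketbrah.
have Pth : dag Pt = Pt by rewrite dag_tens dag1 ketbrah.
have TPsi : T *m Psi = Psi.
  by rewrite tens_mul_ket mul1mx /ketbra -mulmxA tt mulmx1.
have PtPsi : Pt *m Psi = Psi.
  by rewrite tens_mul_ket mul1mx /P /ketbra -mulmxA ZZ mulmx1.
have PtT : Pt *m T = Psi *m dag Psi.
  by rewrite tensmx_mul mul1mx mulmx1 -ketbra_tens.
have TPt : T *m Pt = Psi *m dag Psi by rewrite -[LHS]dagK dagM Th Pth PtT dagM dagK.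
have TT : T *m T = T.
  by rewrite tensmx_mul mul1mx /ketbra -mulmxA (mulmxA (dag t)) tt mul1mx.
have Bcons B X : \tr (((1%:M : 'M[R[i]]_n0) *t B) *m dissipator Lt X) = 0.
  by apply: dissipator_conserved; rewrite ?dag_tens ?dag1 !tensmx_mul !mul1mx !mulmx1.
have stationary A : (forall Gamma, 0 < Gamma ->
      \tr (A *m dissipator Lt (rho_NESS Gamma)) = 0) ->
    dag Psi *m (commutator A H *m Psi) = 0.
  move=> A0; rewrite [LHS]mx11_scalar -mulmx_outer_trace.
  rewrite (mxtrace_limit_eq0 _ Zeno_limit) ?raddf0 // => Gamma Gamma0.
  by apply: (is_NESS_stationary (rho_NESS_unique Gamma Gamma0).1); exact: A0.
pose h := H *m Psi; pose e := dag Psi *m h.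
have eh : dag e = e by rewrite /e /h !dagM dagK Hh mulmxA.
(* The left side is Z (x) w; the conserved observables 1 (x) |t><s| give <s|w> = e <s|t> for every
   [s]. *)
have hPt_e : Pt *m h = Psi *m e.
  have [w wE] := ketbra_tens1_mul Z h.
  rewrite -/P -/Pt in wE; rewrite wE.
  suff -> : w = e 0 0 *: t.
    by rewrite tens_ketZr -mul_mx_scalar -mx11_scalar.
  apply: ket_ext => s.
  have := stationary (1%:M *t (t *m dag s)) (fun _ _ => Bcons _ _).
  rewrite /commutator mulmxBl mulmxBr -(mulmxA H) tens_mul_ket mul1mx.
  have -> : t *m dag s *m t = (dag s *m t) 0 0 *: t.
    by rewrite -mulmxA -mul_mx_scalar -mx11_scalar.
  rewrite tens_ketZr -!scalemxAr -/Psi -/h -/e -(mulmxA _ H) -/h mulmxA.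
  have -> : dag Psi *m (1%:M *t (t *m dag s)) = dag (tens_ket Z s) *m Pt.
    apply: (can_inj (@dagK _ _ _)); rewrite 2!dagM !dagK Pth dag_tens dag1 dagM dagK.
    by rewrite !tens_mul_ket mul1mx -[s *m _ *m _]mulmxA tt mulmx1 /P /ketbra
      -[Z *m _ *m _]mulmxA ZZ mulmx1 mul1mx.
  rewrite -mulmxA wE braket_tens psi_Zeno_unit mul1r /braket -mx11_scalar.
  move/eqP; rewrite subr_eq0 => /eqP ->.
  by apply/matrixP => i j; rewrite !ord1 [LHS]mxE [RHS]mxE mulrC.
have hPt : dag h *m Pt = e *m dag Psi.
  by apply: (can_inj (@dagK _ _ _)); rewrite 2!dagM !dagK Pth eh hPt_e.
(* Splitting [u] along [Z] gives lambda = <Z|u>, and kappa = 1 with the orthogonal remainder. *)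
suff [u hu] : exists u, h = tens_ket u t.
  exists ((dag Z *m u) 0 0), 1, (u - (dag Z *m u) 0 0 *: Z); split.
    rewrite /braket mulmxBr -scalemxAr ZZ scalemx1 -mx11_scalar subrr.
    by rewrite mxE.
  by rewrite -/h hu scale1r -tens_ketZl -tens_ketDl addrC subrK.
have DZ : dissipator L P = 0.
  have : P \in lker (linfun (dissipator L)) by rewrite ker_dissipator memv_line.
  by rewrite memv_ker lfunE => /eqP.
have [c [LZ [c0 | LdZ]]] := pure_stationary_eigen psi_Zeno_unit DZ; last first.
  (* Here [P] commutes with [L] and [dag L], so it is conserved along with the identity. *)
  have P1 : P = 1%:M.
    apply: (pure_kernel_full psi_Zeno_unit ker_dissipator) => X.
      by rewrite -[M in \tr M]mul1mx dissipator_conserved ?mul1mx ?mulmx1.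
    have LPd : dag Z *m L = c *: dag Z.
      by rewrite -[LHS]dagK dagM dagK LdZ dagZ conjCK.
    have LdPd : dag Z *m dag L = c^* *: dag Z by rewrite -dagM LZ dagZ.
    apply: dissipator_conserved; rewrite /ketbra -mulmxA.
      by rewrite LPd mulmxA LZ -scalemxAl -scalemxAr.
    by rewrite LdPd mulmxA LdZ -scalemxAl -scalemxAr.
  exists (e 0 0 *: Z); rewrite tens_ketZl -mul_mx_scalar -mx11_scalar -hPt_e.
  by rewrite /Pt P1 tens1mx1 mul1mx.
have LtPsi : Lt *m Psi = 0.
  by rewrite tens_mul_ket LZ c0 scale0r; apply/matrixP => i j; rewrite !mxE mul0r.
have kerLt X : dissipator Lt X = 0 -> Pt *m X *m Pt = X.
  exact: dissipator_tens_kernel.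
have [A GA] : exists A, forall X,
    \tr (commutator T H *m X) = \tr (A *m dissipator Lt X).
  apply: functional_factor => X /kerLt <-.
  rewrite mulmxA mxtrace_mulC !mulmxA.
  (* Both [Pt *m T] and [T *m Pt] equal |Psi><Psi|, and [hPt_e] with its adjoint turns both products
     into e |Psi><Psi|. *)
  suff -> : Pt *m commutator T H *m Pt = 0 by rewrite mul0mx mxtrace0.
  rewrite /commutator mulmxBr mulmxBl !mulmxA PtT -!mulmxA TPt.
  rewrite (mulmxA H) -/h (mulmxA Pt) hPt_e -!mulmxA.
  by rewrite (mulmxA (dag Psi) H) -{1}Hh -dagM -/h hPt /e /h !mulmxA subrr.
(* Since T h always has the form u (x) t, it remains to show T h = h. *)
have [u hu] := tens1_ketbra_mul t h.
exists u; rewrite -hu; apply/esym.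
apply: (target_invariant Hh Th TT TPsi LtPsi _ _ _ GA).
- by rewrite !tensmx_mul !mul1mx !mulmx1.
- by rewrite dag_tens dag1 !tensmx_mul !mul1mx !mulmx1.
- move=> v Tv Lv.
  (* The coherence |v><Psi| is in the kernel of the dissipator, so [Pt] fixes [v]; with T v = v this
     puts [v] on the line of [Psi]. *)
  have : Pt *m (v *m dag Psi) *m Pt = v *m dag Psi.
    by apply: kerLt; rewrite dissipator_dark_r // -[dag Lt *m Lt *m v]mulmxA Lv
      mulmx0 mul0mx scaler0.
  move/(congr1 (mulmx^~ Psi)); rewrite -!mulmxA PtPsi Psi1 !mulmx1 => Ptv.
  by rewrite -[LHS]Ptv -[v in LHS]Tv !mulmxA PtT.
(* Stationarity for the conserved [T] says that tr([T, H] rho) = tr(A D(rho)) vanishes, which is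
   what stationarity for [A] needs. *)
apply: stationary => Gamma Gamma0; rewrite -GA.
apply: (is_NESS_stationary (rho_NESS_unique Gamma Gamma0).1); exact: Bcons.
Qed.
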